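(* For each $n\ge0$, the group of transformations of $\mathcal C_n$ generated by all maps $\Phi_p:(X,Y)\mapsto(X+p'(Y),Y)$ and $\Psi_q:(X,Y)\mapsto(X,Y-q'(X))$, $p,q\in\mathbb C[z]$, acts transitively on $\mathcal C_n$.
   Context: $\mathcal C_n$ is the set of conjugacy classes (under simultaneous conjugation by $GL_n(\mathbb C)$) of pairs $(X,Y)$ of complex $n\times n$ matrices such that $[X,Y]-I$ has rank at most $1$. The maps $\Phi_p,\Psi_q$ are well defined on conjugacy classes and preserve the rank condition. *)

(* Defs.v *)
From HB Require Import structures.
From mathcomp Require Import all_boot all_order all_algebra.
From mathcomp Require Import complex.
From mathcomp Require Import Rstruct.
From Stdlib Require Import Reals.
Set Implicit Arguments. Unset Strict Implicit. Unset Printing Implicit Defensive.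
Import Order.TTheory GRing.Theory Num.Theory.
Local Open Scope ring_scope.

Notation CC := (complex Rdefinitions.R).

Definition poly_at_mx (n : nat) (p : {poly CC}) (A : 'M[CC]_n) : 'M[CC]_n :=
  \sum_(i < size p) p`_i *: A ^+ i.

(* A point of the Calogero–Moser space (before taking conjugacy classes):
   rank([X,Y] - I) <= 1. *)
Definition CM_pair (n : nat) (X Y : 'M[CC]_n) : Prop :=
  leq (\rank (X *m Y - Y *m X - 1%:M)) 1.

Definition sim_conj (n : nat) (P Q : 'M[CC]_n * 'M[CC]_n) : Prop :=
  exists g : 'M[CC]_n, g \in unitmx /\
    Q.1 = g *m P.1 *m invmx g /\ Q.2 = g *m P.2 *m invmx g.

Inductive CM_gen : Type := Phi of {poly CC} | Psi of {poly CC}.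

Definition act_gen (n : nat) (s : CM_gen) (P : 'M[CC]_n * 'M[CC]_n)
  : 'M[CC]_n * 'M[CC]_n :=
  match s with
  | Phi p => (P.1 + poly_at_mx (deriv p) P.2, P.2)
  | Psi q => (P.1, P.2 - poly_at_mx (deriv q) P.1)
  end.

Definition act_gen_inv (n : nat) (s : CM_gen) (P : 'M[CC]_n * 'M[CC]_n)
  : 'M[CC]_n * 'M[CC]_n :=
  match s with
  | Phi p => (P.1 - poly_at_mx (deriv p) P.2, P.2)
  | Psi q => (P.1, P.2 + poly_at_mx (deriv q) P.1)
  end.

(* An element of the generated group, as a word in generators and inverses
   (letter (true, s) = s, (false, s) = s^-1), acting right-to-left as composition. *)
Definition act_word (n : nat) (w : seq (bool * CM_gen)) (P : 'M[CC]_n * 'M[CC]_n)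
  : 'M[CC]_n * 'M[CC]_n :=
  foldr (fun l Q => if l.1 then act_gen l.2 Q else act_gen_inv l.2 Q) P w.

(* Main.v *)
(* The maps Phi_p and Psi_q do not change [X, Y], so the factorisation [X, Y] - I = v w is
   constant along an orbit up to conjugation.  If w is a cyclic row vector for Y, the equations
   w Y^k v = - tr Y^k determine v from (Y, w), and then X up to a polynomial in Y; hence the pairs
   with w cyclic for Y and with a given characteristic polynomial of Y form a single orbit of the
   maps Phi_p.  The rotation (X, Y) |-> (- Y, X) gives the same for X and the maps Psi_q.

   On K[z]/(p), let C_p be multiplication by z and D the derivation of representatives of degree
   < n: (- D, C_p), acting on row vectors, is a Calogero-Moser pair whose w is the row of p', which
   is always cyclic for D.  As D does not depend on p, all these pairs are equivalent.

   It remains to reach from any pair one where Y has simple spectrum; then w is cyclic for Y by the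
   trace equations, so the pair is equivalent to (- D, C_p) for p the characteristic polynomial of
   Y.  Suppose that no Y + t q(X + r(Y)) has more distinct eigenvalues than Y.  To first order in t
   this says tr (N A) = tr (N^2 A) = 0 for every A = q(X + r(Y)), where N = (Y - l) E and E is the
   spectral idempotent of an eigenvalue l of multiplicity m.  Polarising in r kills
   tr (N^2 X E X) and tr (N X N X), so with Z = E X E one gets 0 = tr ([Z, N]^2) = m (m - 1). *)
Require Import Defs.
From mathcomp Require Import all_boot all_order all_algebra.
From mathcomp Require Import complex Rstruct.
From mathcomp Require Import ring zify.
From Stdlib Require Import Classical.
Set Implicit Arguments.
Unset Strict Implicit.
Unset Printing Implicit Defensive.
Import GRing.Theory Num.Theory.
Local Open Scope ring_scope.

(** * Traces of polynomials in a matrix *)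

Lemma char_poly_uconj (F : fieldType) (n : nat) (P A : 'M[F]_n) :
  P \in unitmx -> char_poly (P *m A *m invmx P) = char_poly A.
Proof.
move=> uP; rewrite /char_poly /char_poly_mx.
have uP' : map_mx polyC P *m map_mx polyC (invmx P) = 1%:M.
  by rewrite -map_mxM mulmxV // map_mx1.
have -> : 'X%:M - map_mx polyC (P *m A *m invmx P) =
   map_mx polyC P *m ('X%:M - map_mx polyC A) *m map_mx polyC (invmx P).
  rewrite mulmxBr mulmxBl !map_mxM; congr (_ - _).
  by rewrite scalar_mxC -mulmxA uP' mulmx1.
by rewrite !det_mulmx mulrAC -det_mulmx uP' det1 mul1r.
Qed.

Lemma trig_mulmx (R : pzSemiRingType) (n : nat) (A B : 'M[R]_n) :
  is_trig_mx A -> is_trig_mx B ->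
  is_trig_mx (A *m B) /\ forall i, (A *m B) i i = A i i * B i i.
Proof.
move=> /is_trig_mxP tA /is_trig_mxP tB; split.
  apply/is_trig_mxP => i j ltij; rewrite mxE big1 // => k _.
  have [ltik|leki] := ltnP i k; first by rewrite tA // mul0r.
  by rewrite tB ?mulr0 // (leq_ltn_trans leki).
move=> i; rewrite mxE (bigD1 i) //= big1 ?addr0 // => k neki.
have [ltik|leki] := ltnP i k; first by rewrite tA // mul0r.
by rewrite tB ?mulr0 // ltn_neqAle leki andbT.
Qed.

Lemma horner_mx_trig (R : comNzRingType) (n : nat) (A : 'M[R]_n.+1) (f : {poly R}) :
  is_trig_mx A ->
  is_trig_mx (horner_mx A f) /\ forall i, horner_mx A f i i = f.[A i i].
Proof.
move=> tA; elim/poly_ind: f => [|f c [tf df]].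
  rewrite rmorph0; split=> [|i]; last by rewrite mxE horner0.
  by apply/is_trig_mxP => i j _; rewrite mxE.
rewrite rmorphD rmorphM /= horner_mx_X horner_mx_C.
have [tfA dfA] := trig_mulmx tf tA; split=> [|i].
  apply/is_trig_mxP => i j ltij; rewrite mxE (is_trig_mxP tfA) //.
  by rewrite mxE -val_eqE ltn_eqF // addr0.
by rewrite mxE dfA df mxE eqxx hornerMXaddC.
Qed.

(** Schur triangularisation: [f] of a triangular matrix has on its diagonal the values of [f] at the
    diagonal entries. *)
Lemma trace_horner (K : numClosedFieldType) (n : nat) (A : 'M[K]_n.+1) (s : seq K)
    (f : {poly K}) :
  char_poly A = \prod_(z <- s) ('X - z%:P) ->
  \tr (horner_mx A f) = \sum_(z <- s) f.[z].
Proof.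
have [P /spectral.unitarymx_unit uP tA] := spectral.Schur A (ltn0Sn n).
rewrite /similar_to conjumx // in tA; set T := _ *m _ in tA.
rewrite -(char_poly_uconj A uP) -/T (char_poly_trig tA) => eqs.
have -> : \tr (horner_mx A f) = \tr (horner_mx T f).
  by rewrite horner_mx_uconj // mxtrace_mulC mulmxA mulVmx // mul1mx.
have [_ df] := horner_mx_trig f tA.
have pst : perm_eq s [seq T i i | i : 'I_n.+1].
  by apply: prod_XsubC_eq; rewrite -eqs big_image.
by rewrite (perm_big _ pst) big_image; apply: eq_bigr => i _; rewrite df.
Qed.

Lemma rank_le1P (F : fieldType) (n : nat) (A : 'M[F]_n) :
  (\rank A <= 1)%N -> exists (v : 'cV_n) (w : 'rV_n), A = v *m w.
Proof.
have := mulmx_base A; move: (col_base A) (row_base A).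
case: (\rank A) => [|[|//]] v w <- _; last by exists v, w.
by exists 0, 0; rewrite mul0mx (flatmx0 w) mulmx0.
Qed.

(** Without repetitions, so that its size counts the distinct eigenvalues. *)
Definition spectrum (K : closedFieldType) (n : nat) (A : 'M[K]_n) : seq K :=
  undup (sval (closed_field_poly_normal (char_poly A))).

Lemma char_poly_roots (K : closedFieldType) (n : nat) (A : 'M[K]_n) :
  char_poly A = \prod_(z <- sval (closed_field_poly_normal (char_poly A))) ('X - z%:P).
Proof.
case: closed_field_poly_normal => s /= {1}->.
by rewrite (monicP (char_poly_monic A)) scale1r.
Qed.

Lemma mem_spectrum (K : closedFieldType) (n : nat) (A : 'M[K]_n) z :
  (z \in spectrum A) = root (char_poly A) z.
Proof. by rewrite char_poly_roots root_prod_XsubC mem_undup. Qed.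

Lemma trace_horner_spectrum (K : numClosedFieldType) (n : nat) (A : 'M[K]_n.+1)
    (f : {poly K}) :
  \tr (horner_mx A f) = \sum_(z <- spectrum A) f.[z] *+ mup z (char_poly A).
Proof.
rewrite (trace_horner f (char_poly_roots A)) -big_undup_iterop_count.
apply: eq_bigr => z _; rewrite [in RHS]char_poly_roots mu_prod_XsubC.
rewrite Monoid.iteropE. by elim: (count_mem _ _) => //= k ->; rewrite mulrS.
Qed.

Lemma mup_spectrum (K : closedFieldType) (n : nat) (A : 'M[K]_n) z :
  (z \in spectrum A) = (0 < mup z (char_poly A))%N.
Proof. by rewrite mem_spectrum -XsubC_dvd ?dvdp_XsubCl ?monic_neq0 ?char_poly_monic. Qed.

(** The trace form factors through evaluation on the spectrum, so its rank is at most the number of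
    distinct eigenvalues. *)
Lemma det_gram_eq0 (K : numClosedFieldType) (n m : nat) (A : 'M[K]_n.+1)
    (F G : 'I_m -> {poly K}) :
  (size (spectrum A) < m)%N ->
  \det (\matrix_(i, j) \tr (horner_mx A (F i * G j))) = 0.
Proof.
move=> ltm; set T := \matrix_(i, j) _.
pose P := \matrix_(i < m, j < size (spectrum A))
  ((F i).[(spectrum A)`_j] *+ mup (spectrum A)`_j (char_poly A)).
pose Q := \matrix_(j < size (spectrum A), i < m) (G i).[(spectrum A)`_j].
have eT : T = P *m Q.
  apply/matrixP => i j; rewrite !mxE trace_horner_spectrum (big_nth 0) big_mkord.
  by apply: eq_bigr => l _; rewrite !mxE hornerM mulrnAl.
apply/eqP; apply: contraTT ltm; rewrite -unitfE -unitmxE -leqNgt => /mxrank_unit <-.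
by rewrite eT (leq_trans (mxrankM_maxl _ _)) // rank_leq_col.
Qed.

(** * First-order perturbation of the spectrum *)

Definition pencil (K : comNzRingType) (n : nat) (M A : 'M[K]_n) : 'M[{poly K}]_n :=
  map_mx polyC M + 'X *: map_mx polyC A.

(** [D] is the derivative of f(M + t A) at t = 0. [M] and [A] need not commute, so only its traces
    against polynomials in [M] simplify; a general [h] carries the induction. *)
Lemma horner_pencil (K : comNzRingType) (n : nat) (M A : 'M[K]_n.+1) (f : {poly K}) :
  exists (D : 'M[K]_n.+1) (E : 'M[{poly K}]_n.+1),
    horner_mx (pencil M A) (map_poly polyC f) =
      map_mx polyC (horner_mx M f) + 'X *: map_mx polyC D + 'X ^+ 2 *: E
    /\ forall h, \tr (D *m horner_mx M h) = \tr (horner_mx M (f^`() * h) *m A).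
Proof.
elim/poly_ind: f => [|f c [D [E [eD tD]]]].
  exists 0, 0; split=> [|h].
    by rewrite !rmorph0 !scaler0 !addr0.
  by rewrite mul0mx deriv0 mul0r rmorph0 mul0mx.
exists (D *m M + horner_mx M f *m A), (E *m pencil M A + map_mx polyC (D *m A)); split.
  rewrite !rmorphD !rmorphM /= !map_polyX !map_polyC /= !horner_mx_X !horner_mx_C eD.
  rewrite -!mulmxE map_scalar_mx /=.
  rewrite mulmxDl -['X^2 *: E *m _]scalemxAl mulmxDl {1 2}/pencil !mulmxDr.
  rewrite -!scalemxAl -!scalemxAr !scalerDr !scalerA -expr2 -!addrA.
  by congr (_ + _); rewrite (AC (1*(1*(1*(1*(1*1))))) (6*(2*(1*(4*(5*3)))))).
move=> h.
rewrite mulmxDl mxtraceD -mulmxA.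
have -> : M *m horner_mx M h = horner_mx M ('X * h) by rewrite rmorphM /= horner_mx_X.
rewrite tD derivD derivM derivC derivX addr0 mulr1 mulrDl rmorphD mulmxDl mxtraceD.
rewrite -!mulrA /=; congr (_ + _).
by rewrite -mulmxA mxtrace_mulC -mulmxA mxtrace_mulC mulrC rmorphM.
Qed.

Lemma poly_nonroot (K : numDomainType) (p : {poly K}) :
  p != 0 -> exists2 t, t != 0 & p.[t] != 0.
Proof.
move=> p0; pose s := [seq i.+1%:R : K | i <- iota 0 (size p)].
have us : uniq s by rewrite map_inj_uniq ?iota_uniq // => i j /eqP; rewrite eqr_nat => /eqP[].
have : ~~ all (root p) s.
  apply: contraTN us => rs; apply: contraL p0 => us; apply/negPn/eqP.
  by apply: (roots_geq_poly_eq0 rs us); rewrite size_map size_iota.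
case/allPn => t /mapP[i _ ->] nr; exists i.+1%:R => //.
by rewrite pnatr_eq0.
Qed.

Definition pencil_trace (K : comNzRingType) (n : nat) (M A : 'M[K]_n.+1) (f : {poly K}) :=
  \tr (horner_mx (pencil M A) (map_poly polyC f)).

Lemma horner_pencil_trace (K : comNzRingType) (n : nat) (M A : 'M[K]_n.+1) (f : {poly K}) t :
  (pencil_trace M A f).[t] = \tr (horner_mx (M + t *: A) f).
Proof.
rewrite -/(horner_eval t _) -trace_map_mx map_horner_mx; congr (\tr (horner_mx _ _)).
  by apply/matrixP => i j; rewrite !mxE; rewrite -[LHS]/(_.[t]) !hornerE.
by rewrite -map_poly_comp map_poly_id // => c _ /=; rewrite /horner_eval hornerC.
Qed.

Lemma pencil_trace_coef1 (K : comNzRingType) (n : nat) (M A : 'M[K]_n.+1) (f : {poly K}) :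
  (pencil_trace M A f)`_1 = \tr (horner_mx M f^`() *m A).
Proof.
have [D [E [eD /(_ 1)]]] := horner_pencil M A f.
rewrite mulr1 rmorph1 mulmx1 /pencil_trace eD => <-.
rewrite !mxtraceD !mxtraceZ !trace_map_mx /=.
by rewrite !coefD coefC coefXM coefC coefXnM /= add0r addr0.
Qed.

(* The Gram matrix of the form (p, q) |-> tr ((p q)(M + t A)) on k + 1 polynomials is singular as
   soon as M + t A has at most k eigenvalues.  Bordering the k polynomials that separate the
   spectrum of M with f and g, its determinant is t times a polynomial in t whose value at 0 is a
   nonzero multiple of tr ((f g)'(M) A). *)
Lemma more_eigenvalues (K : numClosedFieldType) (n : nat) (M A : 'M[K]_n.+1) (f g : {poly K}) :
  (forall z, z \in spectrum M -> root f z) -> (forall z, z \in spectrum M -> root g z) ->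
  \tr (horner_mx M (f * g)^`() *m A) != 0 ->
  exists t, (size (spectrum M) < size (spectrum (M + t *: A)))%N.
Proof.
move=> rf rg tr0; set s := spectrum M; pose k := size s.
(* Lagrange numerators: [e i] vanishes on the spectrum except at its i-th element. *)
pose e (i : 'I_k) : {poly K} := \prod_(z <- s | z != s`_i) ('X - z%:P).
pose T := pencil_trace M A.
(* The last row of the bordered Gram matrix vanishes at t = 0; [drop_poly 1] divides it by t. *)
pose L := block_mx (\matrix_(i < k, j < k) T (e i * e j)) (\matrix_(i < k, j < 1) T (e i * g))
  (\matrix_(i < 1, j < k) drop_poly 1 (T (f * e j)))
  (\matrix_(i < 1, j < 1) drop_poly 1 (T (f * g))).
have us : uniq s by rewrite undup_uniq.
have sE (i : 'I_k) : s`_i \in s by rewrite mem_nth.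
have eE (i : 'I_k) z : z \in s -> ((e i).[z] != 0) = (z == s`_i).
  move=> zs; rewrite horner_prod prodf_seq_neq0; apply/allP/eqP => [h|-> y ys].
    by apply/eqP; have := h z zs; rewrite hornerXsubC subrr eqxx implybF negbK.
  by apply/implyP => ny; rewrite hornerXsubC subr_eq0 eq_sym.
have e0 (i : 'I_k) z : z \in s -> z != s`_i -> (e i).[z] = 0.
  by move=> zs nz; apply/eqP; rewrite -[_ == 0]negbK eE.
have T0 p : (T p).[0] = \tr (horner_mx M p) by rewrite horner_pencil_trace scale0r addr0.
have T0van p : (forall z, z \in s -> root p z) -> (T p).[0] = 0.
  move=> rp; rewrite T0 trace_horner_spectrum big1_seq // => z /= zs.
  by rewrite (eqP (rp z zs)) mul0rn.
(* At t = 0 the block above the corner vanishes because [g] does on the spectrum, and the corner is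
   tr ((f g)'(M) A). *)
have L0 : (\det L).[0] != 0.
  rewrite -/(horner_eval 0 _) -det_map_mx map_block_mx.
  have -> : map_mx (horner_eval 0) (\matrix_(i < k, j < 1) T (e i * g)) = 0.
    apply/matrixP => i j; rewrite !mxE; apply: T0van => z zs.
    by rewrite rootM (rg z zs) orbT.
  rewrite det_lblock mulf_neq0 //.
    rewrite det_trig; last first.
      apply/is_trig_mxP => i j lij; rewrite !mxE; apply: T0van => z zs.
      rewrite rootM; have [->|nz] := eqVneq z s`_i; last by rewrite /root e0 ?eqxx.
      by rewrite orbC /root e0 ?eqxx // nth_uniq // ltn_eqF.
    apply/prodf_neq0 => i _; rewrite !mxE -[X in X != 0]/((T (e i * e i)).[0]) T0.
    rewrite trace_horner_spectrum.
    rewrite (bigD1_seq s`_i) //= big1_seq ?addr0 => [|z /andP[nz zs]].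
      by rewrite -mulr_natr hornerM !mulf_neq0 ?eE // pnatr_eq0 -lt0n -mup_spectrum.
    by rewrite hornerM e0 // mul0r mul0rn.
  rewrite det_mx11 !mxE -[X in X != 0]/((drop_poly 1 (T (f * g))).[0]) horner_coef0.
  by rewrite coef_drop_poly pencil_trace_coef1.
have [t t0 Lt] : exists2 t, t != 0 & (\det L).[t] != 0.
  by apply: poly_nonroot; apply: contraNneq L0 => ->; rewrite horner0.
exists t; rewrite ltnNge; apply: contra Lt => le_k.
pose F (i : 'I_(k + 1)) := if split i is inl j then e j else f.
pose G (i : 'I_(k + 1)) := if split i is inl j then e j else g.
have ltk : (size (spectrum (M + t *: A)) < k + 1)%N by rewrite addn1 ltnS.
have := det_gram_eq0 F G ltk.
have tdrop p : (forall z, z \in s -> root p z) ->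
    t * (drop_poly 1 (T p)).[t] = \tr (horner_mx (M + t *: A) p).
  move=> /T0van p0; rewrite -horner_pencil_trace -/T -[in RHS](poly_take_drop 1 (T p)).
  have -> : take_poly 1 (T p) = 0.
    by apply/polyP => -[|i]; rewrite coef_take_poly coef0 //= -horner_coef0.
  by rewrite add0r expr1 hornerMX mulrC.
have -> : \matrix_(i, j) \tr (horner_mx (M + t *: A) (F i * G j)) =
  block_mx 1%:M 0 0 t%:M *m map_mx (horner_eval t) L.
  rewrite map_block_mx mulmx_block !mul1mx !mul0mx !addr0 !add0r !mul_scalar_mx.
  apply/matrixP => i j; rewrite !mxE /F /G.
  case: split => a; rewrite !mxE; case: split => b; rewrite !mxE.
  - by rewrite -[RHS]/((T _).[t]) horner_pencil_trace.
  - by rewrite -[RHS]/((T _).[t]) horner_pencil_trace.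
  - by rewrite -[RHS]/(t * (drop_poly 1 (T _)).[t]) tdrop // => z zs; rewrite rootM rf.
  - by rewrite -[RHS]/(t * (drop_poly 1 (T _)).[t]) tdrop // => z zs; rewrite rootM rf.
rewrite det_mulmx det_ublock det1 det_scalar1 mul1r det_map_mx => /eqP.
by rewrite mulf_eq0 (negPf t0).
Qed.

(** * Splitting a multiple eigenvalue *)

Lemma trace_mul3C (R : comPzRingType) (n : nat) (A B C : 'M[R]_n) :
  \tr (A *m B *m C) = \tr (C *m A *m B).
Proof. by rewrite mxtrace_mulC mulmxA. Qed.

(* With U = E v w E one has [E X E, N] = E + U, tr U = - tr E and tr (U^2) = (tr U)^2, so the square
   of this commutator has trace tr E (tr E - 1); expanding it instead gives 0. *)
Lemma idempotent_trace (K : numDomainType) (n : nat) (X Y E N : 'M[K]_n) (l : K)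
    (v : 'cV_n) (w : 'rV_n) :
  X *m Y - Y *m X - 1%:M = v *m w ->
  E *m E = E -> E *m N = N -> N *m E = N -> Y *m E = N + l *: E -> E *m Y = N + l *: E ->
  \tr (N *m N *m X *m E *m X) = 0 -> \tr (N *m X *m N *m X) = 0 ->
  \tr E * (\tr E - 1) = 0.
Proof.
move=> cXY EE EN NE YE EY tXEX tNXNX.
pose U := E *m v *m w *m E; pose Q := E *m X *m N - N *m X *m E.
have QU : Q = E + U.
  have -> : U = E *m (X *m Y - Y *m X - 1%:M) *m E by rewrite cXY /U !mulmxA.
  (* Substituting N + l E for Y E and E Y, the two terms in l cancel. *)
  rewrite !mulmxBr !mulmxBl mulmx1 EE addrC subrK !mulmxA EY -!mulmxA YE.
  rewrite !mulmxA mulmxDr !mulmxDl -scalemxAr -!scalemxAl.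
  by rewrite opprD addrACA subrr addr0.
have tU : \tr U = - \tr E.
  apply/eqP; rewrite -addr_eq0 -mxtraceD addrC -QU /Q mxtraceD raddfN /=.
  by rewrite trace_mul3C NE [X in _ - X]trace_mul3C EN subrr.
have UU : \tr (U *m U) = \tr U ^+ 2.
  have -> : U = (E *m v) *m (w *m E) by rewrite !mulmxA.
  have [s es] : exists s, (w *m E) *m (E *m v) = s%:M.
    by exists (((w *m E) *m (E *m v)) 0 0); rewrite -mx11_scalar.
  have -> : \tr (E *m v *m (w *m E)) = s by rewrite mxtrace_mulC es mxtrace_scalar mulr1n.
  rewrite -mulmxA [X in _ *m X]mulmxA es mul_scalar_mx -scalemxAr mxtraceZ.
  by rewrite mxtrace_mulC es mxtrace_scalar mulr1n expr2.
have EU : E *m U = U by rewrite /U !mulmxA EE.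
have UE : U *m E = U by rewrite /U -!mulmxA EE.
(* Up to cyclic permutation, each of the four terms is one of the two traces assumed to vanish. *)
have QQ0 : \tr (Q *m Q) = 0.
  rewrite /Q !mulmxBr !mulmxBl !mxtraceD !raddfN /= !mxtraceD !raddfN /= !mulmxA.
  have EE' Z : Z *m E *m E = Z *m E by rewrite -mulmxA EE.
  have EN' Z : Z *m E *m N = Z *m N by rewrite -mulmxA EN.
  have NE' Z : Z *m N *m E = Z *m N by rewrite -mulmxA NE.
  rewrite !(EE', EN', NE').
  have -> : \tr (E *m X *m N *m X *m N) = 0 by rewrite mxtrace_mulC !mulmxA NE.
  have -> : \tr (N *m X *m E *m X *m N) = 0 by rewrite mxtrace_mulC !mulmxA.
  have -> : \tr (N *m X *m N *m X *m E) = 0 by rewrite mxtrace_mulC !mulmxA EN.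
  have -> : \tr (E *m X *m N *m N *m X *m E) = 0.
    by rewrite mxtrace_mulC !mulmxA EE -!(mulmxA (E *m X)) mxtrace_mulC !mulmxA.
  by rewrite !subr0.
have : \tr (Q *m Q) = \tr E * (\tr E - 1).
  rewrite QU mulmxDl !mulmxDr EE EU UE !mxtraceD UU tU. ring.
by rewrite QQ0 => ->.
Qed.

(* Every A listed is of the form q(X + r) with r a polynomial in E and N: these suffice to isolate
   one term in the expansions of tr (N^2 (X + E)^3) and of tr (N (X + N)^3). *)
Lemma trace_identities (K : numDomainType) (n : nat) (X E N : 'M[K]_n.+1) :
  E * E = E -> E * N = N -> N * E = N ->
  (forall A, A \in [:: X ^+ 3; (X + N) ^+ 3] -> \tr (N * A) = 0) ->
  (forall A, A \in [:: 1; X; X ^+ 2; X ^+ 3; (X + E) ^+ 3; X + N ^+ 2; (X + N) ^+ 2] ->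
     \tr (N * N * A) = 0) ->
  \tr (N * N * X * E * X) = 0 /\ \tr (N * X * N * X) = 0.
Proof.
move=> EE EN NE tN tNN.
have tN4 : \tr (N * N * N * N) = 0.
  have := tNN (X + N ^+ 2); rewrite !inE eqxx ?orbT => /(_ isT).
  rewrite mulrDr mxtraceD tNN ?inE ?eqxx ?orbT // add0r expr2 !mulrA.
  by [].
have EE' Z : Z * E * E = Z * E by rewrite -mulrA EE.
have EN' Z : Z * E * N = Z * N by rewrite -mulrA EN.
have NE' Z : Z * N * E = Z * N by rewrite -mulrA NE.
have t0 : \tr (N * N) = 0 by rewrite -[N * N]mulr1 tNN ?inE ?eqxx.
have t1 : \tr (N * N * X) = 0 by rewrite tNN ?inE ?eqxx ?orbT.
have t2 : \tr (N * N * X * X) = 0 by rewrite -mulrA -expr2 tNN ?inE ?eqxx ?orbT.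
have t3 : \tr (N * N * X * X * X) = 0.
  by have := tNN (X ^+ 3); rewrite !inE eqxx ?orbT exprSr expr2 !mulrA => /(_ isT).
have t3' : \tr (N * X * X * X) = 0.
  by have := tN (X ^+ 3); rewrite !inE eqxx ?orbT exprSr expr2 !mulrA => /(_ isT).
have trC (A B : 'M[K]_n.+1) : \tr (A * B) = \tr (B * A) by rewrite -mulmxE mxtrace_mulC.
have tNNN : \tr (N * N * N * X) = 0.
  have := tNN ((X + N) ^+ 2); rewrite !inE eqxx ?orbT => /(_ isT).
  rewrite expr2 !(mulrDl, mulrDr) !mulrA !mxtraceD t2 tN4 add0r addr0.
  rewrite [\tr (N * N * X * N)]trC !mulrA -mulr2n => /eqP.
  by rewrite mulrn_eq0 => /eqP.
split.
  have := tNN ((X + E) ^+ 3); rewrite !inE eqxx ?orbT => /(_ isT).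
  rewrite exprSr expr2 !(mulrDl, mulrDr) !mulrA !mxtraceD.
  have -> : \tr (N * N * X * X * E) = 0 by rewrite trC !mulrA EN.
  rewrite !(EE', EN', NE') t3 t2 t1 t0.
  have -> : \tr (N * N * X * E) = 0 by rewrite trC !mulrA EN.
  by rewrite !(add0r, addr0).
have := tN ((X + N) ^+ 3); rewrite !inE eqxx ?orbT => /(_ isT).
rewrite exprSr expr2 !(mulrDl, mulrDr) !mulrA !mxtraceD t3' t2 tNNN tN4.
have -> : \tr (N * X * X * N) = 0 by rewrite trC !mulrA.
have -> : \tr (N * X * N * N) = 0 by rewrite trC !mulrA trC !mulrA.
have -> : \tr (N * N * X * N) = 0 by rewrite trC !mulrA.
by rewrite !(add0r, addr0).
Qed.

Lemma dvdp_deriv_mul_sqr (F : fieldType) (u a : {poly F}) : a %| (u * a ^+ 2)^`().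
Proof.
by rewrite expr2 !derivM dvdp_add ?dvdp_mull ?dvdp_add ?dvdp_mulIl ?dvdp_mulIr.
Qed.

Lemma horner_mx_dvd_char_poly (F : fieldType) (n : nat) (A : 'M[F]_n.+1) (f : {poly F}) :
  char_poly A %| f -> horner_mx A f = 0.
Proof. by case/dvdpP => q ->; rewrite rmorphM /= Cayley_Hamilton mulr0. Qed.

(** The multiplicities add up to tr 1 = n + 1, more than the number of distinct eigenvalues. *)
Lemma exists_multiple_eigenvalue (K : numClosedFieldType) (n : nat) (A : 'M[K]_n.+1) :
  (size (spectrum A) < n.+1)%N -> exists z, (1 < mup z (char_poly A))%N.
Proof.
move=> lts; have := trace_horner_spectrum A 1; rewrite rmorph1 mxtrace1.
have [/hasP[z _ mz] _|/hasPn le1] := boolP (has (fun z => 1 < mup z (char_poly A))%N (spectrum A)).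
  by exists z.
rewrite (eq_bigr (fun z => (mup z (char_poly A))%:R)) => [|z _]; last by rewrite hornerC.
rewrite -natr_sum => /eqP; rewrite eqr_nat => /eqP eqn.
move: lts; rewrite ltnNge [X in (X <= _)%N]eqn -sum1_size big_seq [X in (_ <= X)%N]big_seq.
by rewrite leq_sum // => z /le1; rewrite -leqNgt.
Qed.

(* Interpolating to order 2m at the roots of multiplicity m, rather than m, makes e'(A) vanish. *)
Lemma spectral_idempotent (F : fieldType) (n : nat) (A : 'M[F]_n.+1) (l : F) :
  root (char_poly A) l ->
  exists e : {poly F}, [/\ char_poly A %| e * (e - 1), char_poly A %| e^`(), e.[l] = 1
    & forall z, root (char_poly A) z -> z != l -> root e z].
Proof.
have [m [q]] := multiplicity_XsubC (char_poly A) l.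
rewrite monic_neq0 ?char_poly_monic //= => nq eq rl.
pose a := ('X - l%:P) ^+ m.
have al : a.[l] = 0.
  by apply/eqP; move: rl; rewrite eq rootM (negPf nq).
have cqa : coprimep a q by rewrite coprimep_expl // coprimep_sym coprimep_XsubC.
(* From u a^2 + v q^2 = 1, the polynomial v q^2 is 1 modulo a^2 and 0 modulo q^2. *)
have /Bezout_eq1_coprimepP[[u v] /= uv] : coprimep (a ^+ 2) (q ^+ 2).
  by rewrite coprimep_expl // coprimep_expr.
have e1 : v * q ^+ 2 - 1 = - u * a ^+ 2 by rewrite -uv opprD addrCA subrr addr0 mulNr.
exists (v * q ^+ 2); rewrite eq mulrC -/a; split.
- by rewrite e1 mulrC; apply: dvdp_mul; rewrite dvdp_mull // dvdp_exp.
- rewrite Gauss_dvdp // dvdp_deriv_mul_sqr andbT.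
  by rewrite -[v * _](subrK 1) e1 derivD derivC addr0 dvdp_deriv_mul_sqr.
- by rewrite -[v * _](subrK 1) e1 hornerD hornerM horner_exp al hornerC expr0n mulr0 add0r.
move=> z; rewrite rootM => /orP[|rq _]; last by rewrite rootM expr2 rootM rq !orbT.
rewrite /a; case: (m) => [|k]; last by rewrite root_exp_XsubC => ->.
by rewrite expr0 /root hornerE oner_eq0.
Qed.

(** Otherwise [more_eigenvalues] makes tr ((f g)'(Y) A) vanish for all A = q(X + p(Y)) and all f, g
    vanishing on the spectrum, and [idempotent_trace] yields m (m - 1) = 0 at an eigenvalue of
    multiplicity m > 1. *)
Lemma shiota_step (K : numClosedFieldType) (n : nat) (X Y : 'M[K]_n.+1) (v : 'cV_n.+1)
    (w : 'rV_n.+1) :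
  X *m Y - Y *m X - 1%:M = v *m w -> (size (spectrum Y) < n.+1)%N ->
  exists p q, (size (spectrum Y) < size (spectrum (Y + horner_mx (X + horner_mx Y p) q)))%N.
Proof.
move=> cXY /exists_multiple_eigenvalue[l ml]; apply: NNPP => no.
have max f g p q : (forall z, z \in spectrum Y -> root f z) ->
    (forall z, z \in spectrum Y -> root g z) ->
    \tr (horner_mx Y (f * g)^`() *m horner_mx (X + horner_mx Y p) q) = 0.
  move=> rf rg; apply: NNPP => /eqP /(more_eigenvalues rf rg)[t ht].
  by apply: no; exists p, (t *: q); rewrite horner_mxZ.
have rl : root (char_poly Y) l by rewrite -mem_spectrum mup_spectrum ltnW.
have [e [ee de el er]] := spectral_idempotent rl.
(* nu(Y) is the nilpotent part of Y at the eigenvalue l. *)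
pose nu := ('X - l%:P) * e.
have rnu z : z \in spectrum Y -> root nu z.
  rewrite mem_spectrum => rz; rewrite rootM root_XsubC.
  by have [//|/(er z rz)] := eqVneq z l.
pose E := horner_mx Y e; pose N := horner_mx Y nu.
have EE : E * E = E.
  apply/eqP; rewrite -subr_eq0 -[X in _ - X]mulr1 -mulrBr.
  by rewrite -(rmorph1 (horner_mx Y)) -rmorphB -rmorphM /= horner_mx_dvd_char_poly.
have YlE : N = (Y - l%:M) * E by rewrite /N rmorphM rmorphB /= horner_mx_X horner_mx_C.
have comEY : E * Y = Y * E by apply: comm_horner_mx.
have NE : N * E = N by rewrite YlE -mulrA EE.
have EN : E * N = N by rewrite -[RHS]NE; exact: comm_horner_mx2.
(* Here e'(Y) = 0 is used. It follows that (nu^2)'(Y) = 2 N and (nu^3)'(Y) = 3 N^2. *)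
have dnu : horner_mx Y nu^`() = E.
  rewrite derivM derivB derivX derivC subr0 mul1r rmorphD rmorphM /=.
  by rewrite (horner_mx_dvd_char_poly de) mulr0 addr0.
clearbody nu.
have tN p q : \tr (N * horner_mx (X + horner_mx Y p) q) = 0.
  have := max nu nu p q rnu rnu; rewrite derivM [nu * _]mulrC rmorphD rmorphM /= dnu EN.
  by rewrite mulmxDl mxtraceD -mulr2n => /eqP; rewrite mulrn_eq0 => /eqP.
have tNN p q : \tr (N * N * horner_mx (X + horner_mx Y p) q) = 0.
  have rnu2 z : z \in spectrum Y -> root (nu * nu) z by move/rnu => rz; rewrite rootM rz.
  have := max (nu * nu) nu p q rnu2 rnu.
  have -> : horner_mx Y (nu * nu * nu)^`() = (N * N) *+ 3.
    rewrite !derivM !rmorphD !rmorphM /= rmorphD !rmorphM /= dnu -/N EN NE -[N * N * E]mulrA NE.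
    by rewrite mulrDl !mulrS addrA addr0.
  by rewrite -scaler_nat -scalemxAl mxtraceZ => /eqP; rewrite mulf_eq0 pnatr_eq0 => /eqP.
have pE : X + E = X + horner_mx Y e by [].
have X0 : X = X + horner_mx Y 0 by rewrite rmorph0 addr0.
have [] := @trace_identities _ _ X E N EE EN NE.
- move=> A; rewrite !inE => /orP[/eqP ->|/eqP ->].
    by rewrite X0 -[_ + _](horner_mx_X) -rmorphXn tN.
  by rewrite -[_ + _](horner_mx_X) -rmorphXn tN.
- have t1 := tNN 0 1; rewrite rmorph1 in t1.
  have tX q : \tr (N * N * horner_mx X q) = 0 by rewrite X0 tNN.
  have tXp p k : \tr (N * N * (X + horner_mx Y p) ^+ k) = 0.
    by rewrite -{1}(horner_mx_X (X + _)) -rmorphXn tNN.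
  move=> A; rewrite !inE => /orP[/eqP -> //|/orP[/eqP ->|]].
    by have := tXp 0 1; rewrite -X0.
  move=> /orP[/eqP ->|]; first by have := tXp 0 2; rewrite -X0.
  move=> /orP[/eqP ->|]; first by have := tXp 0 3; rewrite -X0.
  move=> /orP[/eqP ->|/orP[/eqP ->|/eqP ->]]; [exact: (tXp e 3)| |exact: (tXp nu 2)].
  by have := tXp (nu ^+ 2) 1; rewrite rmorphXn.
move=> t1 t2.
have YE : Y *m E = N + l *: E.
  by rewrite YlE mulrBl -[l%:M * E]/(l%:M *m E) mul_scalar_mx subrK.
have := idempotent_trace cXY EE EN NE YE _ t1 t2.
rewrite mulmxE comEY => /(_ YE).
have -> : \tr E = (mup l (char_poly Y))%:R.
  rewrite trace_horner_spectrum (bigD1_seq l) ?undup_uniq ?mem_spectrum //= el.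
  rewrite big1_seq ?addr0 // => z /andP[nz]; rewrite mem_spectrum => rz.
  by rewrite (eqP (er z rz nz)) mul0rn.
move/eqP; rewrite mulf_eq0 subr_eq0 -[1](mulr1n) !pnatr_eq1.
by rewrite pnatr_eq0 => /orP[] /eqP m0; rewrite m0 in ml.
Qed.

(** * Cyclic pairs *)

(** Invertible exactly when [w] is a cyclic row vector for [Y]. *)
Definition krylov (F : fieldType) (n : nat) (w : 'rV[F]_n.+1) (Y : 'M[F]_n.+1) : 'M[F]_n.+1 :=
  \matrix_(i < n.+1) (w *m Y ^+ i).

Lemma mul_krylov (F : fieldType) (n : nat) (w : 'rV[F]_n.+1) (Y : 'M[F]_n.+1) (u : 'rV_n.+1) :
  u *m krylov w Y = w *m horner_mx Y (rVpoly u).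
Proof.
rewrite mulmx_sum_row /rVpoly poly_def rmorph_sum /= mulmx_sumr.
apply: eq_bigr => i _; rewrite rowK linearZ /= rmorphXn /= horner_mx_X -scalemxAr.
by rewrite valK.
Qed.

(** As f(Y) commutes with Y, tr (f(Y) [X, Y]) = 0 and only the term - 1 contributes. *)
Lemma trace_pairing (F : fieldType) (n : nat) (X Y : 'M[F]_n.+1) (v : 'cV_n.+1) (w : 'rV_n.+1)
    (f : {poly F}) :
  X *m Y - Y *m X - 1%:M = v *m w ->
  (w *m horner_mx Y f *m v) 0 0 = - \tr (horner_mx Y f).
Proof.
move=> cXY; rewrite -trace_mx11.
rewrite -mulmxA mxtrace_mulC -mulmxA -cXY !mulmxBr mulmx1 !mxtraceD !raddfN /=.
have -> : horner_mx Y f *m (Y *m X) = Y *m (horner_mx Y f *m X).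
  by rewrite !mulmxA (comm_horner_mx (A := Y)).
by rewrite mulmxA [\tr (Y *m _)]mxtrace_mulC subrr add0r.
Qed.

(** If w u(Y) = 0, then tr ((u g)(Y)) = 0 for every g. Taking g to vanish at all eigenvalues but z
    gives u(z) = 0, and u has too many roots for its degree. *)
Lemma krylov_unit (K : numClosedFieldType) (n : nat) (X Y : 'M[K]_n.+1) (v : 'cV_n.+1)
    (w : 'rV_n.+1) :
  X *m Y - Y *m X - 1%:M = v *m w -> (n < size (spectrum Y))%N -> krylov w Y \in unitmx.
Proof.
move=> cXY sY; rewrite -row_free_unit; apply: inj_row_free => u.
rewrite mul_krylov => wf; rewrite -[u]rVpolyK.
rewrite (@roots_geq_poly_eq0 _ (rVpoly u) (spectrum Y)) ?raddf0 ?undup_uniq //; last first.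
  by rewrite (leq_trans (size_poly _ _)).
apply/allP => z zs; pose g : {poly K} := \prod_(x <- spectrum Y | x != z) ('X - x%:P).
have := trace_pairing (rVpoly u * g) cXY.
rewrite rmorphM /= -mulmxE mulmxA wf !mul0mx => /eqP; rewrite mxE eq_sym oppr_eq0.
rewrite mulmxE -rmorphM trace_horner_spectrum (bigD1_seq z) ?undup_uniq //=.
rewrite big1_seq ?addr0 => [|x /andP[nx xs]].
  rewrite mulrn_eq0 eqn0Ngt -mup_spectrum zs hornerM mulf_eq0 /= => /orP[//|].
  rewrite horner_prod prodf_seq_eq0 => /hasP[x _ /andP[nx]].
  by rewrite hornerXsubC subr_eq0 eq_sym (negPf nx).
have /eqP gx : g.[x] == 0.
  by rewrite horner_prod prodf_seq_eq0; apply/hasP; exists x; rewrite // nx hornerXsubC subrr /=.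
by rewrite hornerM gx mulr0 mul0rn.
Qed.

(** * The model pairs (- D, C_p) *)

Definition lin_poly_mx (F : fieldType) (n : nat) (L : {poly F} -> {poly F}) : 'M[F]_n :=
  \matrix_(i < n) poly_rV (L 'X^i).

Lemma mul_lin_poly_mx (F : fieldType) (n : nat) (L : {poly F} -> {poly F}) (p : {poly F}) :
  linear L -> (size p <= n)%N -> poly_rV p *m lin_poly_mx n L = poly_rV (L p).
Proof.
move=> linL lep.
have LD : {morph L : p q / p + q} by move=> a b; have := linL 1 a b; rewrite !scale1r.
have L0 : L 0 = 0 by have := linL (-1) 0 0; rewrite scaler0 addr0 scaleN1r addNr.
have LZ a q : L (a *: q) = a *: L q by have := linL a q 0; rewrite L0 !addr0.
have {2}-> : p = \sum_(i < n) p`_i *: 'X^i.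
  rewrite -poly_def -[LHS](poly_rV_K lep); apply/polyP => i; rewrite coef_poly coef_rVpoly.
  by case: insubP => [j -> <-|/negPf ->//]; rewrite mxE.
rewrite (big_morph L LD L0) raddf_sum mulmx_sum_row; apply: eq_bigr => i _.
by rewrite rowK mxE LZ /= linearZ.
Qed.

Definition companion (F : fieldType) (n : nat) (p : {poly F}) : 'M[F]_n :=
  lin_poly_mx n (fun q => ('X * q) %% p).

(** Row i is w Y^(i+1) on both sides; Cayley-Hamilton allows the reduction modulo the characteristic
    polynomial. *)
Lemma krylov_companion (F : fieldType) (n : nat) (w : 'rV[F]_n.+1) (Y : 'M[F]_n.+1) :
  krylov w Y *m Y = companion n.+1 (char_poly Y) *m krylov w Y.
Proof.
apply/row_matrixP => i; rewrite !row_mul !rowK mul_krylov poly_rV_K; last first.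
  by rewrite -ltnS -(size_char_poly Y) ltn_modp monic_neq0 ?char_poly_monic.
rewrite -mulmxA mulmxE -exprSr -[Y in LHS]horner_mx_X -rmorphXn exprS.
congr (_ *m _); rewrite {1}(divp_eq ('X * 'X^i) (char_poly Y)) rmorphD rmorphM /=.
by rewrite Cayley_Hamilton mulr0 add0r.
Qed.

Lemma row0_krylov (F : fieldType) (n : nat) (w : 'rV[F]_n.+1) (Y : 'M[F]_n.+1) :
  row 0 (krylov w Y) = w.
Proof. by rewrite rowK expr0 mulmx1. Qed.

Lemma cyclic_fiber (F : fieldType) (n : nat) (X Y X' Y' : 'M[F]_n.+1) (v v' : 'cV_n.+1)
    (w w' : 'rV_n.+1) :
  X *m Y - Y *m X - 1%:M = v *m w -> X' *m Y' - Y' *m X' - 1%:M = v' *m w' ->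
  krylov w Y \in unitmx -> krylov w' Y' \in unitmx -> char_poly Y = char_poly Y' ->
  exists p g, [/\ g \in unitmx, X' = g *m (X + horner_mx Y p) *m invmx g
                & Y' = g *m Y *m invmx g].
Proof.
move=> cXY cXY' uK uK' eqc.
(* Both Krylov matrices lead to the same companion matrix, so [g] carries (Y, w) to (Y', w'). *)
pose g := invmx (krylov w' Y') *m krylov w Y.
have ug : g \in unitmx by rewrite unitmx_mul unitmx_inv uK uK'.
have gY : g *m Y = Y' *m g.
  have -> : Y' = invmx (krylov w' Y') *m companion n.+1 (char_poly Y') *m krylov w' Y'.
    by rewrite -mulmxA -krylov_companion mulKmx.
  by rewrite -eqc -!mulmxA krylov_companion mulKVmx.
have wg : w' *m g = w.
  by rewrite -[w' in LHS](row0_krylov _ Y') -row_mul mulKVmx // row0_krylov.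
clearbody g.
pose X1 := invmx g *m X' *m g; pose v1 := invmx g *m v'.
have cX1 : X1 *m Y - Y *m X1 - 1%:M = v1 *m w.
  have -> : Y = invmx g *m Y' *m g by rewrite -mulmxA -gY mulKmx.
  have cj A B : (invmx g *m A *m g) *m (invmx g *m B *m g) = invmx g *m (A *m B) *m g.
    by rewrite !mulmxA mulmxK.
  have <- : invmx g *m 1%:M *m g = 1%:M by rewrite mulmx1 mulVmx.
  by rewrite !cj -!mulmxBl -!mulmxBr cXY' -wg !mulmxA.
(* The pairings w Y^i v = - tr Y^i determine v, since w is cyclic. *)
have vv : v = v1.
  apply: (can_inj (mulKmx uK)); apply/row_matrixP => i.
  have eYi : Y ^+ i = horner_mx Y 'X^i by rewrite rmorphXn /= horner_mx_X.
  apply/matrixP => a b; rewrite !ord1 !row_mul !rowK eYi.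
  by rewrite (trace_pairing _ cXY) (trace_pairing _ cX1).
have cD : (X1 - X) *m Y = Y *m (X1 - X).
  have : X1 *m Y - Y *m X1 = X *m Y - Y *m X by apply: (addIr (- 1%:M)); rewrite cXY cX1 vv.
  move/(canRL (subrK _)) => eX.
  by rewrite mulmxBl mulmxBr eX addrAC [X *m Y - _]addrC addrK addrC.
(* Chosen so that w p(Y) = w (X1 - X); matrices commuting with Y that agree on the cyclic vector w
   are equal. *)
pose p := rVpoly (w *m (X1 - X) *m invmx (krylov w Y)).
have Dp : X1 - X = horner_mx Y p.
  apply: (can_inj (mulKmx uK)); apply/row_matrixP => i; rewrite !row_mul !rowK.
  have -> : w *m Y ^+ i *m (X1 - X) = w *m (X1 - X) *m Y ^+ i.
    by rewrite -!mulmxA; congr (_ *m _); apply/esym/(commrX i cD).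
  have -> : w *m Y ^+ i *m horner_mx Y p = w *m horner_mx Y p *m Y ^+ i.
    rewrite -!mulmxA; congr (_ *m _); apply/esym/(commrX i).
    exact: comm_horner_mx.
  by rewrite -mul_krylov mulmxKV.
exists p, g; split=> //; last by rewrite gY mulmxK.
by rewrite -Dp addrC subrK /X1 !mulmxA mulmxV // mul1mx mulmxK.
Qed.

Lemma linear_deriv (F : fieldType) : linear (@deriv F).
Proof. by move=> a p q; rewrite derivD derivZ. Qed.

Lemma linear_mulX_mod (F : fieldType) (p : {poly F}) : linear (fun q => ('X * q) %% p).
Proof. by move=> a q r; rewrite mulrDr -scalerAr modpD modpZl. Qed.

(* Row vectors stand for polynomials of degree <= n, and matrices act on the right, which reverses
   composition: hence the sign of D.  The defect of [d/dz, z] = 1 comes from reducing z^(n+1). *)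
Lemma companion_deriv_commutator (F : fieldType) (n : nat) (p : {poly F}) :
  p \is monic -> size p = n.+2 ->
  let D := lin_poly_mx n.+1 deriv in
  (- D) *m companion n.+1 p - companion n.+1 p *m (- D) - 1%:M =
  - delta_mx ord_max 0 *m poly_rV p^`().
Proof.
move=> mp sp D; rewrite mulNmx mulmxN opprK; apply/row_matrixP => i.
rewrite !(linearB, linearD, linearN) /= !row_mul !rowK.
have XdXn (k : nat) : 'X * ('X^k)^`() = 'X^k *+ k :> {poly F}.
  by rewrite derivXn mulrnAr; case: k => // k; rewrite -exprS.
have small (q : {poly F}) : (size q <= n.+1)%N -> q %% p = q by move=> sq; rewrite modp_small // sp.
have sXn : (size ('X^i : {poly F}) <= n.+1)%N by rewrite size_polyXn.
have sXnk k : (size ('X^i *+ k : {poly F}) <= n.+1)%N.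
  by rewrite -scaler_nat (leq_trans (size_scale_leq _ _)).
rewrite !mul_lin_poly_mx; first last.
- by rewrite (leq_trans (size_poly _ _)) // size_polyXn /= ltnW.
- exact: linear_mulX_mod.
- by rewrite -ltnS -sp ltn_modp monic_neq0.
- exact: linear_deriv.
have -> : row i (1%:M : 'M[F]_n.+1) = poly_rV 'X^i.
  by apply/rowP => j; rewrite !mxE coefXn eq_sym.
rewrite XdXn (small _ (sXnk i)).
have -> : row i (- delta_mx ord_max 0 : 'cV[F]_n.+1) = - (i == ord_max)%:R%:M.
  by apply/matrixP => a b; rewrite !mxE !ord1 eqxx andbT mulr1n.
rewrite mulNmx mul_scalar_mx -exprS -!raddfN -!raddfD /=.
have [->|ni] := eqVneq i ord_max.
  have -> : 'X^(n.+1) %% p = 'X^(n.+1) - p.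
    rewrite -{1}['X^_](subrK p) addrC -{1}[p]mul1r modp_addl_mul_small // sp ltnS.
    apply/leq_sizeP => l; rewrite leq_eqVlt coefB coefXn => /orP[/eqP <-|nl].
      by rewrite eqxx -(monicP mp) lead_coefE sp subrr.
    by rewrite gtn_eqF // nth_default ?subrr // sp.
  by rewrite scale1r derivB derivXn /= mulrS; congr poly_rV; ring.
rewrite small ?size_polyXn ?scale0r ?oppr0; last first.
  by rewrite ltnS ltn_neqAle -[n]/(val (ord_max : 'I_n.+1)) (inj_eq val_inj) ni leq_ord.
transitivity (poly_rV (0 : {poly F}) : 'rV_n.+1); last exact: raddf0.
by rewrite derivXn /= mulrS; congr poly_rV; ring.
Qed.

(** Up to sign the rows are p', p'', ..., of degrees n, n - 1, ..., 0: a triangular system in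
    characteristic zero. *)
Lemma companion_deriv_cyclic (F : numFieldType) (n : nat) (p : {poly F}) :
  p \is monic -> size p = n.+2 ->
  krylov (poly_rV p^`()) (- lin_poly_mx n.+1 deriv) \in unitmx.
Proof.
move=> mp sp; rewrite -row_free_unit; apply: inj_row_free => u uK.
have rowE (k : 'I_n.+1) j : krylov (poly_rV p^`()) (- lin_poly_mx n.+1 deriv) k j =
    (-1) ^+ k * (p`_(k.+1 + j) *+ (k.+1 + j) ^_ k.+1).
  have -> : krylov (poly_rV p^`()) (- lin_poly_mx n.+1 deriv) k j =
    (poly_rV p^`() *m (- lin_poly_mx n.+1 deriv) ^+ k) 0 j.
    by rewrite mxE.
  have -> : poly_rV p^`() *m (- lin_poly_mx n.+1 deriv) ^+ k = (-1) ^+ k *: poly_rV p^`(k.+1).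
    elim: (k : nat) => [|m IHm]; first by rewrite mulmx1 scale1r.
    rewrite exprSr mulmxA IHm mulmxN -scalemxAl mul_lin_poly_mx.
    - by rewrite exprSr mulrN1 scaleNr.
    - exact: linear_deriv.
    apply/leq_sizeP => l nl; rewrite coef_derivn nth_default ?mul0rn // sp.
    by rewrite addSn !ltnS (leq_trans nl) // leq_addl.
  by rewrite !mxE coef_derivn.
have uz m : (m < n.+1)%N -> forall k : 'I_n.+1, k = m :> nat -> u 0 k = 0.
  elim/ltn_ind: m => m IHm ltm k ekm.
  (* In column n - k, row k holds the leading coefficient of p and the rows below vanish. *)
  have /rowP/(_ (rev_ord k)) := uK; rewrite mxE (bigD1 k) //= big1 ?addr0; last first.
    move=> i nik; have [lik|lki] := ltnP i k.
      by rewrite (IHm i _ _ i) ?mul0r // -ekm.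
    rewrite rowE nth_default ?mul0rn ?mulr0 // sp /= subSS.
    have {nik lki} lki : (k < i)%N by rewrite ltn_neqAle eq_sym nik.
    by have := ltn_ord k; lia.
  rewrite rowE /= [X in _ = X]mxE subSS addSn subnKC ?leq_ord // => /eqP.
  rewrite !mulf_eq0 signr_eq0 /= mulrn_eq0 => /orP[/eqP //|].
  have -> : p`_n.+1 = 1 by rewrite -(monicP mp) lead_coefE sp.
  by rewrite oner_eq0 orbF -leqn0 leqNgt ffact_gt0 ltnS leq_ord.
by apply/rowP => k; rewrite (uz k) ?mxE.
Qed.

(** * Orbits *)

(** Arbitrary polynomials replace derivatives and conjugation is a move, so the argument runs over
    any suitable field. *)
Inductive cm_equiv (F : fieldType) (n : nat) :
    'M[F]_n.+1 * 'M[F]_n.+1 -> 'M[F]_n.+1 * 'M[F]_n.+1 -> Prop :=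
| cm_phi X Y p : cm_equiv (X, Y) (X + horner_mx Y p, Y)
| cm_psi X Y p : cm_equiv (X, Y) (X, Y + horner_mx X p)
| cm_conj g X Y : g \in unitmx ->
    cm_equiv (X, Y) (g *m X *m invmx g, g *m Y *m invmx g)
| cm_trans P Q R : cm_equiv P Q -> cm_equiv Q R -> cm_equiv P R.

Lemma cm_refl (F : fieldType) (n : nat) (P : 'M[F]_n.+1 * 'M[F]_n.+1) : cm_equiv P P.
Proof. by case: P => X Y; have := cm_phi X Y 0; rewrite rmorph0 addr0. Qed.

Lemma cm_sym (F : fieldType) (n : nat) (P Q : 'M[F]_n.+1 * 'M[F]_n.+1) :
  cm_equiv P Q -> cm_equiv Q P.
Proof.
elim=> {P Q} [X Y p|X Y p|g X Y ug|P Q R _ QP _ RQ].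
- by have := cm_phi (X + horner_mx Y p) Y (- p); rewrite rmorphN addrK.
- by have := cm_psi X (Y + horner_mx X p) (- p); rewrite rmorphN addrK.
- have := @cm_conj _ _ (invmx g) (g *m X *m invmx g) (g *m Y *m invmx g).
  by rewrite unitmx_inv invmxK !mulmxA mulVmx // !mul1mx !mulmxKV //; apply.
exact: cm_trans RQ QP.
Qed.

Lemma commutator_phi (F : fieldType) (n : nat) (X Y : 'M[F]_n.+1) (p : {poly F}) :
  (X + horner_mx Y p) *m Y - Y *m (X + horner_mx Y p) = X *m Y - Y *m X.
Proof.
rewrite mulmxDl mulmxDr opprD addrACA.
by rewrite [horner_mx Y p *m Y](comm_horner_mx (A := Y)) // subrr addr0.
Qed.

Lemma commutator_psi (F : fieldType) (n : nat) (X Y : 'M[F]_n.+1) (p : {poly F}) :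
  X *m (Y + horner_mx X p) - (Y + horner_mx X p) *m X = X *m Y - Y *m X.
Proof.
rewrite mulmxDl mulmxDr opprD addrACA.
by rewrite [horner_mx X p *m X](comm_horner_mx (A := X)) // subrr addr0.
Qed.

(** Iterates [shiota_step], by induction on the number of eigenvalues still missing; the moves fix
    [X, Y], hence v w. *)
Lemma cm_simple_spectrum (K : numClosedFieldType) (n : nat) (X Y : 'M[K]_n.+1) (v : 'cV_n.+1)
    (w : 'rV_n.+1) :
  X *m Y - Y *m X - 1%:M = v *m w ->
  exists X1 Y1, [/\ cm_equiv (X, Y) (X1, Y1), X1 *m Y1 - Y1 *m X1 - 1%:M = v *m w
    & (n < size (spectrum Y1))%N].
Proof.
have [k lek] := ubnP (n.+1 - size (spectrum Y))%N.
elim: k X Y lek => // k IHk X Y; rewrite ltnS => lek cXY.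
have [lts|les] := ltnP (size (spectrum Y)) n.+1; last first.
  by exists X, Y; split=> //; exact: cm_refl.
have [p [q ltpq]] := shiota_step cXY lts.
set X1 := X + horner_mx Y p in ltpq; set Y1 := Y + horner_mx X1 q in ltpq.
have [||X2 [Y2 [e12 c2 s2]]] := IHk X1 Y1.
- by apply: leq_trans lek; rewrite ltn_sub2l.
- by rewrite commutator_psi commutator_phi.
exists X2, Y2; split=> //; apply: cm_trans e12.
exact: cm_trans (cm_phi X Y p) (cm_psi X1 Y q).
Qed.

Lemma cm_equiv_companion (K : numClosedFieldType) (n : nat) (X Y : 'M[K]_n.+1) (v : 'cV_n.+1)
    (w : 'rV_n.+1) :
  X *m Y - Y *m X - 1%:M = v *m w ->
  exists p, [/\ p \is monic, size p = n.+2
    & cm_equiv (X, Y) (- lin_poly_mx n.+1 deriv, companion n.+1 p)].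
Proof.
case/cm_simple_spectrum => X1 [Y1 [e1 c1 s1]].
pose p := char_poly Y1.
have mp : p \is monic := char_poly_monic Y1.
have sp : size p = n.+2 := size_char_poly Y1.
have uK := krylov_unit c1 s1.
have ep : char_poly (companion n.+1 p) = p.
  have -> : companion n.+1 p = krylov w Y1 *m Y1 *m invmx (krylov w Y1).
    by rewrite krylov_companion mulmxK.
  by rewrite char_poly_uconj.
have c2 := companion_deriv_commutator mp sp; cbv zeta in c2.
(* Simple spectrum makes the row of p' cyclic for C_p, so [cyclic_fiber] applies. *)
have s2 : (n < size (spectrum (companion n.+1 p)))%N by rewrite /spectrum ep.
exists p; split=> //; apply: cm_trans e1 _.
have [//|q [g [ug eX eY]]] := cyclic_fiber c1 c2 uK (krylov_unit c2 s2).
apply: cm_trans (cm_phi X1 Y1 q) _.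
by rewrite eX eY; exact: cm_conj.
Qed.

(* [cyclic_fiber] applied to the rotated pairs [(- Y, X)], which have the same commutators. *)
Lemma cm_equiv_companion2 (F : numFieldType) (n : nat) (p q : {poly F}) :
  p \is monic -> size p = n.+2 -> q \is monic -> size q = n.+2 ->
  cm_equiv (- lin_poly_mx n.+1 deriv, companion n.+1 p)
           (- lin_poly_mx n.+1 deriv, companion n.+1 q).
Proof.
move=> mp sp mq sq.
have := companion_deriv_cyclic mq sq; have := companion_deriv_cyclic mp sp.
have := companion_deriv_commutator mq sq; have := companion_deriv_commutator mp sp.
cbv zeta; set D := - lin_poly_mx n.+1 deriv.
have rot (A B : 'M[F]_n.+1) : A *m B - B *m A = (- B) *m A - A *m (- B).
  by rewrite mulNmx mulmxN opprK addrC.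
rewrite !(rot D) => cp cq up uq.
have [//|r [g [ug eY eX]]] := cyclic_fiber cp cq up uq.
(* Adding r(D) to - C_p amounts to subtracting it from C_p. *)
apply: cm_trans (cm_psi _ _ (- r)) _.
have := cm_conj D (companion n.+1 p + horner_mx D (- r)) ug; rewrite -eX.
rewrite rmorphN -[_ + - horner_mx D r]opprK opprD opprK.
by rewrite mulmxN mulNmx -eY opprK.
Qed.

Lemma cm_equiv_transitive (K : numClosedFieldType) (n : nat) (X Y X' Y' : 'M[K]_n.+1) :
  (\rank (X *m Y - Y *m X - 1%:M)%R <= 1)%N ->
  (\rank (X' *m Y' - Y' *m X' - 1%:M)%R <= 1)%N ->
  cm_equiv (X, Y) (X', Y').
Proof.
move=> /rank_le1P[v [w /cm_equiv_companion[p [mp sp ep]]]].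
move=> /rank_le1P[v' [w' /cm_equiv_companion[q [mq sq /cm_sym eq]]]].
exact: cm_trans ep (cm_trans (cm_equiv_companion2 mp sp mq sq) eq).
Qed.

(** * From the equivalence to words in the generators *)

Lemma antiderivative (F : numFieldType) (p : {poly F}) : exists q, q^`() = p.
Proof.
(* At i = 0 the convention 1 / 0 = 0 makes the constant term 0. *)
exists (\poly_(i < (size p).+1) (p`_i.-1 / i%:R)); apply/polyP => i.
rewrite coef_deriv coef_poly ltnS; have [lti|lei] := ltnP i (size p).
  by rewrite -[LHS]mulr_natr mulfVK // pnatr_eq0.
by rewrite mul0rn nth_default.
Qed.

Lemma poly_at_mxE (n : nat) (p : {poly CC}) (A : 'M[CC]_n.+1) :
  poly_at_mx p A = horner_mx A p.
Proof.
rewrite -[p in RHS]coefK poly_def rmorph_sum /=; apply: eq_bigr => i _.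
by rewrite linearZ /= rmorphXn /= horner_mx_X.
Qed.

Definition conj_pair (n : nat) (g : 'M[CC]_n.+1) (P : 'M[CC]_n.+1 * 'M[CC]_n.+1) :=
  (g *m P.1 *m invmx g, g *m P.2 *m invmx g).

(** Lets conjugations interspersed among the moves be collected into a single final one. *)
Lemma act_word_conj (n : nat) (g : 'M[CC]_n.+1) (w : seq (bool * CM_gen)) P :
  g \in unitmx -> act_word w (conj_pair g P) = conj_pair g (act_word w P).
Proof.
move=> ug; elim: w => //= -[b s] w ->.
case: (act_word w P) => A B; rewrite /conj_pair.
case: b s => -[p|p] /=; rewrite !poly_at_mxE horner_mx_uconj //.
- by rewrite mulmxDr mulmxDl.
- by rewrite mulmxDr mulmxDl mulmxN mulNmx.
- by rewrite mulmxDr mulmxDl mulmxN mulNmx.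
by rewrite mulmxDr mulmxDl.
Qed.

Lemma act_word_cat (n : nat) (w1 w2 : seq (bool * CM_gen)) (P : 'M[CC]_n * 'M[CC]_n) :
  act_word (w1 ++ w2) P = act_word w1 (act_word w2 P).
Proof. exact: foldr_cat. Qed.

Definition orbit_equiv (n : nat) (P Q : 'M[CC]_n * 'M[CC]_n) :=
  exists w, sim_conj (act_word w P) Q.

Lemma orbit_trans (n : nat) (P Q R : 'M[CC]_n.+1 * 'M[CC]_n.+1) :
  orbit_equiv P Q -> orbit_equiv Q R -> orbit_equiv P R.
Proof.
case: Q => Q1 Q2; case: R => R1 R2 [w1 [g [ug [/= eQ1 eQ2]]]] [w2 [h [uh [/= eR1 eR2]]]].
exists (w2 ++ w1), (h *m g); rewrite unitmx_mul uh ug; split=> //=.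
have eQ : (Q1, Q2) = conj_pair g (act_word w1 P) by rewrite eQ1 eQ2.
rewrite act_word_cat eR1 eR2 eQ act_word_conj //=.
have -> : invmx (h *m g) = invmx g *m invmx h by exact: invrM.
by rewrite !mulmxA.
Qed.

Lemma orbit_phi (n : nat) (X Y : 'M[CC]_n.+1) (p : {poly CC}) :
  orbit_equiv (X, Y) (X + horner_mx Y p, Y).
Proof.
have [q dq] := antiderivative p.
exists [:: (true, Phi q)], 1%:M; rewrite unitmx1 invmx1 !mul1mx !mulmx1 /=.
by rewrite poly_at_mxE dq.
Qed.

Lemma orbit_psi (n : nat) (X Y : 'M[CC]_n.+1) (p : {poly CC}) :
  orbit_equiv (X, Y) (X, Y + horner_mx X p).
Proof.
have [q dq] := antiderivative p.
(* [Psi q] subtracts q'(X), so its inverse is the letter that adds it. *)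
exists [:: (false, Psi q)], 1%:M; rewrite unitmx1 invmx1 !mul1mx !mulmx1 /=.
by rewrite poly_at_mxE dq.
Qed.

Lemma cm_equiv_orbit (n : nat) (P Q : 'M[CC]_n.+1 * 'M[CC]_n.+1) :
  cm_equiv P Q -> orbit_equiv P Q.
Proof.
elim=> {P Q} [X Y p|X Y p|g X Y ug|P Q R _ PQ _ QR].
- exact: orbit_phi.
- exact: orbit_psi.
- by exists [::], g.
exact: orbit_trans PQ QR.
Qed.

Unset Implicit Arguments.
Set Strict Implicit.

Theorem theorem1p3 (n : nat) (X Y X' Y' : 'M[CC]_n) :
  CM_pair X Y -> CM_pair X' Y' ->
  exists w : seq (bool * CM_gen), sim_conj (act_word w (X, Y)) (X', Y').
Proof.
case: n X Y X' Y' => [|n] X Y X' Y'.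
  (* For n = 0 all matrices coincide. *)
  move=> _ _; exists [::], 1%:M; rewrite unitmx1; split=> //.
  by split; rewrite [LHS]flatmx0 [RHS]flatmx0.
by move=> cP cQ; apply: cm_equiv_orbit; apply: cm_equiv_transitive.
Qed.
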